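(* Fix the problem data and the spatial grid. There exists $\tau_0>0$ such that for every time step $0<\tau\le\tau_0$ the following holds: if $0\le n\le N-1$ and $U^n\in X_{JK}$ is a solution of the CNFD scheme at time level $n$ (i.e. $U^0,\dots,U^n$ satisfy the scheme up to level $n$), then there exists a unique solution $U^{n+1}\in X_{JK}$ of the CNFD scheme at the next time level, i.e. a unique $U^{n+1}\in X_{JK}$ such that for all $(j,k)\in\mathcal{T}_{JK}$, with $U^{n+1/2}=\frac12(U^{n+1}+U^n)$, $$i\delta_t^+U^n_{j,k}+\delta^2U^{n+1/2}_{j,k}+\lambda\psi_1(U^{n+1}_{j,k},U^n_{j,k})-\nu\psi_2(U^{n+1}_{j,k},U^n_{j,k})+i\varepsilon\varphi(U^{n+1}_{j,k},U^n_{j,k})=0.$$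
   Context: Problem data: $\lambda\in\mathbb{R}$, $\nu>0$, $\varepsilon\ge 0$, $T>0$; $\Omega=(a,b)\times(c,d)\subset\mathbb{R}^2$; $u_0:\overline\Omega\to\mathbb{C}$, vanishing on $\partial\Omega$. Grid: $x_j=a+j\Delta x$, $\Delta x=(b-a)/J$, $y_k=c+k\Delta y$, $\Delta y=(d-c)/K$, for $0\le j\le J$, $0\le k\le K$, with $\Delta x=\Delta y=h$. Time grid: $t_n=n\tau$, $n=0,\dots,N$, $N\tau=T$. $\mathcal{T}_{JK}=\{(j,k):1\le j\le J-1,\ 1\le k\le K-1\}$. $X_{JK}$ is the space of complex grid functions $u=(u_{j,k})_{0\le j\le J,\,0\le k\le K}$ with $u_{0,k}=u_{J,k}=u_{j,0}=u_{j,K}=0$ for all $j,k$. Difference operators: $\delta_t^+u^n_{j,k}=(u^{n+1}_{j,k}-u^n_{j,k})/\tau$, $\delta^2u_{j,k}=\frac{u_{j+1,k}-2u_{j,k}+u_{j-1,k}}{(\Delta x)^2}+\frac{u_{j,k+1}-2u_{j,k}+u_{j,k-1}}{(\Delta y)^2}$. For $z,w\in\mathbb{C}$: $\psi_1(z,w)=\frac{|z|^2+|w|^2}{2}\cdot\frac{z+w}{2}$, $\psi_2(z,w)=\frac{|z|^4+|z|^2|w|^2+|w|^4}{3}\cdot\frac{z+w}{2}$, $\varphi(z,w)=\left|\frac{z+w}{2}\right|^2\frac{z+w}{2}$. CNFD scheme: $U^0_{j,k}=u_0(x_j,y_k)$ for $0\le j\le J$, $0\le k\le K$, and for each $n=0,\dots,N-1$,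 $U^{n+1}\in X_{JK}$ satisfies, with $U^{n+1/2}=\frac12(U^{n+1}+U^n)$, $$i\delta_t^+U^n_{j,k}+\delta^2U^{n+1/2}_{j,k}+\lambda\psi_1(U^{n+1}_{j,k},U^n_{j,k})-\nu\psi_2(U^{n+1}_{j,k},U^n_{j,k})+i\varepsilon\varphi(U^{n+1}_{j,k},U^n_{j,k})=0$$ for all $(j,k)\in\mathcal{T}_{JK}$. ''$U^0,\dots,U^n$ satisfy the scheme up to level $n$'' means that $U^0_{j,k}=u_0(x_j,y_k)$ for $0\le j\le J$, $0\le k\le K$, and that for $l=0,\dots,n-1$ one has $U^{l+1}\in X_{JK}$ and, with $U^{l+1/2}=\frac12(U^{l+1}+U^l)$, $$i\delta_t^+U^l_{j,k}+\delta^2U^{l+1/2}_{j,k}+\lambda\psi_1(U^{l+1}_{j,k},U^l_{j,k})-\nu\psi_2(U^{l+1}_{j,k},U^l_{j,k})+i\varepsilon\varphi(U^{l+1}_{j,k},U^l_{j,k})=0$$ for all $(j,k)\in\mathcal{T}_{JK}$. *)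

(* Defs.v *)
From HB Require Import structures.
From mathcomp Require Import all_boot all_order all_algebra.
From mathcomp Require Import all_classical all_reals all_analysis.
From mathcomp Require Import complex.

Set Implicit Arguments.
Unset Strict Implicit.
Unset Printing Implicit Defensive.

Import Order.TTheory GRing.Theory Num.Theory.
Import numFieldNormedType.Exports.

Local Open Scope classical_set_scope.
Local Open Scope ring_scope.
Local Open Scope complex_scope.

Definition rectangle (R : realType) (a b c d : R) : set (R * R) :=
  `]a, b[ `*` `]c, d[.

Definition boundary (T : topologicalType) (A : set T) : set T :=
  closure A `\` interior A.

Definition mesh (R : realType) (a b : R) (J : nat) : R := (b - a) / J%:R.

Definition node (R : realType) (a b : R) (J j : nat) : R :=
  a + j%:R * mesh a b J.

Notation grid R J K := 'M[R[i]]_(J.+1, K.+1).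

Definition sample (R : realType) (a b c d : R) (J K : nat)
    (u0 : R * R -> R[i]) : grid R J K :=
  \matrix_(j, k) u0 (node a b J j, node c d K k).

Definition inner_index (J K : nat) (j : 'I_J.+1) (k : 'I_K.+1) : bool :=
  (0 < j < J)%N && (0 < k < K)%N.

(* The space X_{JK}. *)
Definition zero_bdry (R : realType) (J K : nat) (u : grid R J K) : Prop :=
  (forall k, u ord0 k = 0 /\ u ord_max k = 0) /\
  (forall j, u j ord0 = 0 /\ u j ord_max = 0).

(* [inord] truncates out-of-range indices, so this is the five-point Laplacian
   at inner indices only. *)
Definition delta2 (R : realType) (J K : nat) (dx dy : R) (u : grid R J K)
    (j : 'I_J.+1) (k : 'I_K.+1) : R[i] :=
  (u (inord j.+1) k - 2 * u j k + u (inord j.-1) k) / dx%:C ^+ 2 +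
  (u j (inord k.+1) - 2 * u j k + u j (inord k.-1)) / dy%:C ^+ 2.

Definition psi1 (R : realType) (z w : R[i]) : R[i] :=
  (`|z| ^+ 2 + `|w| ^+ 2) / 2 * ((z + w) / 2).

Definition psi2 (R : realType) (z w : R[i]) : R[i] :=
  (`|z| ^+ 4 + `|z| ^+ 2 * `|w| ^+ 2 + `|w| ^+ 4) / 3 * ((z + w) / 2).

Definition phi (R : realType) (z w : R[i]) : R[i] :=
  `|(z + w) / 2| ^+ 2 * ((z + w) / 2).

(* [u] is the known time level and [v] the next one. *)
Definition cnfd_eq (R : realType) (lambda nu eps : R) (J K : nat)
    (dx dy tau : R) (u v : grid R J K) : Prop :=
  forall (j : 'I_J.+1) (k : 'I_K.+1), inner_index j k ->
    'i * ((v j k - u j k) / tau%:C)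
    + delta2 dx dy (2^-1 *: (v + u)) j k
    + lambda%:C * psi1 (v j k) (u j k)
    - nu%:C * psi2 (v j k) (u j k)
    + 'i * eps%:C * phi (v j k) (u j k) = 0.

Definition cnfd_step (R : realType) (lambda nu eps : R) (J K : nat)
    (dx dy tau : R) (u v : grid R J K) : Prop :=
  zero_bdry v /\ cnfd_eq lambda nu eps dx dy tau u v.

(* Only the levels U 0, ..., U n are constrained. *)
Definition cnfd_upto (R : realType) (lambda nu eps a b c d : R)
    (u0 : R * R -> R[i]) (J K : nat) (tau : R)
    (U : nat -> grid R J K) (n : nat) : Prop :=
  U 0%N = sample a b c d J K u0 /\
  forall l : nat, (l < n)%N ->
    cnfd_step lambda nu eps (mesh a b J) (mesh c d K) tau (U l) (U l.+1).

(* Main.v *)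
Require Import Defs.
From HB Require Import structures.
From mathcomp Require Import all_boot all_order all_algebra.
From mathcomp Require Import all_classical all_reals all_analysis.
From mathcomp Require Import complex ring lra zify.

Set Implicit Arguments.
Unset Strict Implicit.
Unset Printing Implicit Defensive.

Import Order.TTheory GRing.Theory Num.Theory.
Import numFieldNormedType.Exports.

Local Open Scope classical_set_scope.
Local Open Scope ring_scope.
Local Open Scope complex_scope.

(** On a fixed grid the scheme is an implicit one-step method for an ordinary
    differential equation in a finite-dimensional space.  Solved for the
    increment, it reads V = U + i tau F(U, V), where F collects the Laplacian of
    the midpoint and the nonlinear terms.  Every entry of F is a polynomial in
    the entries of U and V and their moduli, so F is bounded and Lipschitz in V
    on each ball ([cnfd_rhs_lipschitz]).  Once U lies in a fixed ball and tau is
    small, V |-> U + i tau F(U, V) maps a larger ball to itself and contracts it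
    ([step_map_contraction]), and Banach's fixed point theorem gives a solution.

    Two points remain.  The threshold on tau must depend neither on the time
    level nor on tau itself, and uniqueness must be proved among all grid
    functions, not only those of a ball.  Both follow from the decay of the
    discrete mass, i.e. of the sum of |U_{j,k}|^2 over the inner nodes
    ([mass_step]).  Multiply the scheme by the conjugate of the midpoint
    W = (V + U)/2, take imaginary parts and sum: the time difference gives
    (mass V - mass U)/(2 tau); the lambda and nu terms are real multiples of
    |W|^2 and vanish; the eps term gives eps |W|^4, which is nonnegative; and
    the Laplacian vanishes after summation by parts, because W is zero on the
    boundary ([sum_Im_delta2]).  Hence the mass never exceeds that of the
    initial sample, and this bounds the entries of all U^n and of every possible
    U^{n+1}.

    Summation by parts at the first step needs the initial sample to vanish at
    the boundary nodes; these lie on the topological boundary of the rectangle,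
    where u0 is zero ([sample_zero_bdry]). *)

(** * Locally Lipschitz functions of two grids *)

Definition entry_bound (C : numDomainType) (m n : nat) (r : C)
    (u : 'M[C]_(m, n)) : Prop :=
  forall j k, `|u j k| <= r.

Section LocallyLipschitz.
Variables (C : numDomainType) (m n : nat) (I : Type).
Implicit Types f g : I -> 'M[C]_(m, n) -> 'M[C]_(m, n) -> C.

(** The constant is uniform in the index i and in the first grid, so that one
    threshold on the time step serves all nodes and all time levels.  Entrywise
    bounds d replace the norm of v - w, a maximum of moduli that an order which
    is only partial, such as that of the complex numbers, need not provide. *)
Definition locally_lipschitz f : Prop :=
  forall r, exists L,
    (forall i u v, entry_bound r u -> entry_bound r v -> `|f i u v| <= L) /\
    (forall i u v w d, 0 <= d ->
       entry_bound r u -> entry_bound r v -> entry_bound r w ->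
       entry_bound d (v - w) -> `|f i u v - f i u w| <= L * d).

Lemma lipschitz_cst (c : C) : locally_lipschitz (fun _ _ _ => c).
Proof.
move=> r; exists `|c|; split=> // i u v w d d0 _ _ _ _.
by rewrite subrr normr0 mulr_ge0.
Qed.

Lemma lipschitz_known (j : I -> 'I_m) (k : I -> 'I_n) :
  locally_lipschitz (fun i u _ => u (j i) (k i)).
Proof.
move=> r; exists r; split=> [i u v ur _|i u v w d d0 ur _ _ _]; first exact: ur.
by rewrite subrr normr0 mulr_ge0// (le_trans _ (ur (j i) (k i))).
Qed.

Lemma lipschitz_new (j : I -> 'I_m) (k : I -> 'I_n) :
  locally_lipschitz (fun i _ v => v (j i) (k i)).
Proof.
(* r bounds the value and 1 is the Lipschitz constant; both are needed in L. *)
move=> r; exists (r + 1); split=> [i u v _ vr|i u v w d d0 _ vr _ vwd].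
  by rewrite (le_trans (vr _ _))// lerDl.
have r0 : 0 <= r by exact: le_trans (vr (j i) (k i)).
have := vwd (j i) (k i); rewrite !mxE => /le_trans; apply.
by rewrite mulrDl mul1r lerDr mulr_ge0.
Qed.

Lemma lipschitzD f g : locally_lipschitz f -> locally_lipschitz g ->
  locally_lipschitz (fun i u v => f i u v + g i u v).
Proof.
move=> lf lg r; have [Lf [f1 f2]] := lf r; have [Lg [g1 g2]] := lg r.
exists (Lf + Lg); split=> [i u v ur vr|i u v w d d0 ur vr wr vw].
  by rewrite (le_trans (ler_normD _ _))//; apply: lerD; [exact: f1|exact: g1].
rewrite opprD addrACA mulrDl (le_trans (ler_normD _ _))//.
by apply: lerD; [exact: f2|exact: g2].
Qed.

Lemma lipschitzM f g : locally_lipschitz f -> locally_lipschitz g ->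
  locally_lipschitz (fun i u v => f i u v * g i u v).
Proof.
move=> lf lg r; have [Lf [f1 f2]] := lf r; have [Lg [g1 g2]] := lg r.
exists (Lf * Lg + Lf * Lg); split=> [i u v ur vr|i u v w d d0 ur vr wr vw].
  have fg : `|f i u v * g i u v| <= Lf * Lg by rewrite normrM ler_pM ?f1 ?g1.
  by rewrite (le_trans fg)// lerDl (le_trans _ fg).
rewrite (_ : _ - _ = f i u v * (g i u v - g i u w)
                   + (f i u v - f i u w) * g i u w); last by ring.
rewrite (le_trans (ler_normD _ _))// !normrM mulrDl; apply: lerD.
  by rewrite -mulrA ler_pM ?f1 ?g2.
by rewrite mulrAC ler_pM ?g1 ?f2.
Qed.

Lemma lipschitz_norm f : locally_lipschitz f ->
  locally_lipschitz (fun i u v => `|f i u v|).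
Proof.
move=> lf r; have [L [f1 f2]] := lf r.
exists L; split=> [i u v ur vr|i u v w d d0 ur vr wr vw].
  by rewrite normr_id f1.
by rewrite (le_trans (ler_dist_dist _ _))// f2.
Qed.

Lemma lipschitzX f p : locally_lipschitz f ->
  locally_lipschitz (fun i u v => f i u v ^+ p).
Proof.
move=> lf; elim: p => [|p lfp]; first exact: lipschitz_cst.
move=> r; have [L fp] := lipschitzM lf lfp r.
by exists L; split=> *; rewrite !exprS; apply fp.
Qed.

Lemma lipschitzN f : locally_lipschitz f ->
  locally_lipschitz (fun i u v => - f i u v).
Proof.
move=> lf r; have [L [f1 f2]] := lf r.
exists L; split=> *; first by rewrite normrN f1.
by rewrite -opprD normrN f2.
Qed.

End LocallyLipschitz.

(** * Fixed points of contractions of complex grids *)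

(** Real matrices are both complete and normed; this declares the join of the
    two structures, which the Banach fixed point theorem asks for. *)
HB.instance Definition _ (R : realType) (m n : nat) := Complete.on 'M[R]_(m, n).

Lemma mx_norm_le (R : realType) (m n : nat) (x : 'M[R]_(m, n)) (r : R) :
  0 <= r -> `|x| <= r <-> forall i j, `|x i j| <= r.
Proof.
move=> r0; rewrite [`|x|]mx_normrE; split=> [/bigmax_leP[_ xr] i j|xr].
  exact: (xr (i, j)).
by apply/bigmax_leP; split=> // -[i j] _; exact: xr.
Qed.

Lemma normc_ge_Im (R : realType) (z : R[i]) : `|complex.Im z|%:C <= `|z|.
Proof.
by rewrite normc_def lecR -sqrtr_sqr ler_wsqrtr// lerDr sqr_ge0.
Qed.

Lemma normc_le_ReIm (R : realType) (z : R[i]) :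
  `|z| <= (`|complex.Re z| + `|complex.Im z|)%:C.
Proof.
rewrite normc_def lecR -[leRHS]ger0_norm ?addr_ge0//.
rewrite -sqrtr_sqr ler_wsqrtr// sqrrD !real_normK ?num_real//.
by rewrite -addrA lerD2l lerDr mulrn_wge0 ?mulr_ge0.
Qed.

Section FixedPoint.
Variables (R : realType) (m n : nat).

Let realify (v : 'M[R[i]]_(m, n)) : 'M[R]_(m + m, n) :=
  col_mx (\matrix_(j, k) complex.Re (v j k)) (\matrix_(j, k) complex.Im (v j k)).

Let complexify (x : 'M[R]_(m + m, n)) : 'M[R[i]]_(m, n) :=
  \matrix_(j, k) (x (lshift m j) k +i* x (rshift m j) k).

Let realifyK v : complexify (realify v) = v.
Proof.
apply/matrixP => j k; rewrite mxE col_mxEu col_mxEd !mxE.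
by case: (v j k).
Qed.

Let realifyB v w : realify v - realify w = realify (v - w).
Proof.
apply/matrixP => i k; case: (split_ordP i) => j ->;
by rewrite /realify !(col_mxEu, col_mxEd, mxE);
  case: (v j k) (w j k) => [? ?] [? ?].
Qed.

Let complexifyB x y : complexify x - complexify y = complexify (x - y).
Proof. by apply/matrixP => j k; rewrite !mxE. Qed.

Let norm_realify (r : R) v : 0 <= r -> entry_bound r%:C v -> `|realify v| <= r.
Proof.
move=> r0 vr; apply/mx_norm_le => // i k; rewrite -lecR.
case: (split_ordP i) => j ->; rewrite ?col_mxEu ?col_mxEd !mxE.
  exact: le_trans (normc_ge_Re _) (vr j k).
exact: le_trans (normc_ge_Im _) (vr j k).
Qed.

Let bound_complexify (r : R) x : `|x| <= r ->
  entry_bound (2 * r)%:C (complexify x).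
Proof.
move=> xr j k; have r0 : 0 <= r by exact: le_trans xr.
move/mx_norm_le: xr => /(_ r0) xr.
rewrite !mxE (le_trans (normc_le_ReIm _))// lecR mulr_natl mulr2n.
by apply: lerD; exact: xr.
Qed.

(** Banach's theorem applies to real normed spaces, hence the passage through
    the stacked real and imaginary parts.  The maximum norm of the real grid and
    the entrywise modulus differ by a factor of up to 2, which explains the
    radius 2 r in the hypotheses; the contraction factor 1/4 becomes 1/2. *)
Lemma complex_grid_fixpoint (Phi : 'M[R[i]]_(m, n) -> 'M[R[i]]_(m, n)) (r : R) :
  0 < r ->
  (forall v, entry_bound (2 * r)%:C v -> entry_bound r%:C (Phi v)) ->
  (forall v w (d : R), 0 <= d ->
     entry_bound (2 * r)%:C v -> entry_bound (2 * r)%:C w ->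
     entry_bound d%:C (v - w) -> entry_bound (d / 4)%:C (Phi v - Phi w)) ->
  exists v, Phi v = v.
Proof.
move=> r0 Phir Phic.
pose U : set 'M[R]_(m + m, n) := closed_ball 0 r.
have UE x : U x <-> `|x| <= r.
  by rewrite /U closed_ballE//= /closed_ball_/= sub0r normrN.
pose F x := realify (Phi (complexify x)).
have FU : set_fun U U F.
  move=> x /UE xr; apply/UE; apply: norm_realify (ltW r0) _.
  by apply: Phir; exact: bound_complexify.
have Fc : is_contraction (mkfun_fun FU).
  exists (2^-1)%:nng; split=> /=; first by lra.
  move=> [x y] /= [/UE xr /UE yr]; rewrite realifyB.
  apply: norm_realify; first by rewrite mulr_ge0.
  rewrite (_ : _ * _ = 2 * `|x - y| / 4); last by field.
  apply: Phic; [by rewrite mulr_ge0|exact: bound_complexify..|].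
  by rewrite complexifyB; exact: bound_complexify.
have Ucl : closed U by exact: closed_ball_closed.
have [|x _ /= xF] := banach_fixed_point Fc Ucl.
  by exists 0; apply/UE; rewrite normr0 ltW.
exists (complexify x); rewrite [in RHS]xF; exact/esym/realifyK.
Qed.

(** The largest modulus of an entry of v - w is at most a quarter of itself, so
    it is zero. *)
Lemma complex_grid_fixpoint_unique
    (Phi : 'M[R[i]]_(m, n) -> 'M[R[i]]_(m, n)) (r : R) :
  (forall v w (d : R), 0 <= d ->
     entry_bound (2 * r)%:C v -> entry_bound (2 * r)%:C w ->
     entry_bound d%:C (v - w) -> entry_bound (d / 4)%:C (Phi v - Phi w)) ->
  forall v w, entry_bound (2 * r)%:C v -> entry_bound (2 * r)%:C w ->
    Phi v = v -> Phi w = w -> v = w.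
Proof.
move=> Phic v w vr wr Pv Pw.
pose x : 'M[R]_(m, n) := \matrix_(j, k) complex.Re `|(v - w) j k|.
have xE j k : `|(v - w) j k| = (x j k)%:C.
  by rewrite [x j k]mxE RRe_real// normr_real.
have /mx_norm_le := lexx `|x|; move=> /(_ (normr_ge0 _)) le_x.
have : entry_bound (`|x| / 4)%:C (v - w).
  rewrite -{1}Pv -{1}Pw; apply: Phic => // j k.
  by rewrite xE lecR (le_trans (ler_norm _)).
move=> vw; have x0 : `|x| <= 0.
  suff : `|x| <= `|x| / 4 by lra.
  apply/mx_norm_le; first by rewrite divr_ge0.
  move=> j k; rewrite ger0_norm; first by rewrite -lecR -xE; exact: vw.
  by rewrite -ler0c -xE.
apply/eqP; rewrite -subr_eq0; apply/eqP/matrixP => j k; rewrite [RHS]mxE.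
apply/eqP; rewrite -normr_le0 (le_trans (vw j k))//.
by rewrite -[0]/(0%:C) lecR; lra.
Qed.

End FixedPoint.

(** * Conservation of mass by the discrete Laplacian *)

Definition sqnorm (R : realType) (z : R[i]) : R :=
  complex.Re z ^+ 2 + complex.Im z ^+ 2.

Lemma sqnorm_ge0 (R : realType) (z : R[i]) : 0 <= sqnorm z.
Proof. by rewrite addr_ge0 ?sqr_ge0. Qed.

Lemma sqr_normcE (R : realType) (z : R[i]) : `|z| ^+ 2 = (sqnorm z)%:C.
Proof. by rewrite -add_Re2_Im2. Qed.

(** Summation by parts: each term is the difference of two consecutive values
    of the discrete flux Im (f_j conj(f_{j-1})), which vanishes at both ends. *)
Lemma sum_Im_laplacian (R : realType) (n : nat) (f : nat -> R[i]) :
  (0 < n)%N -> f 0 = 0 -> f n = 0 ->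
  \sum_(1 <= j < n)
     complex.Im ((f j.+1 - 2 * f j + f j.-1) * (f j)^*%C) = 0.
Proof.
move=> n0 f0 fn.
pose flux j := complex.Im (f j * (f j.-1)^*%C).
rewrite (eq_bigr (fun j => flux j.+1 - flux j)) => [|j _]; last first.
  rewrite /flux /=; case: (f j.+1) (f j) (f j.-1) => [a b] [c d] [e g].
  by rewrite mulrDl mulrDl; simpc => /=; ring.
by rewrite telescope_sumr// /flux fn f0 mul0r conjc0 mulr0 subrr.
Qed.

(** Passage to natural indices, in which the neighbours of a node are j.+1 and
    j.-1 and sums telescope. *)
Lemma sum_inner_ord (R : realType) (n : nat) (F : 'I_n.+1 -> R) : (0 < n)%N ->
  \sum_(j < n.+1 | (0 < j < n)%N) F j = \sum_(1 <= j < n) F (inord j).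
Proof.
move=> n0; rewrite (eq_bigr (fun j : 'I_n.+1 => F (inord j))); last first.
  by move=> j _; rewrite inord_val.
rewrite -(big_mkord (fun j => (0 < j < n)%N) (fun j => F (inord j))).
rewrite big_ltn_cond//= big_mkcond big_nat_recr//= ltnn andbF addr0.
rewrite -big_mkcond big_nat_cond [RHS]big_nat_cond.
by apply: eq_bigl => j; lia.
Qed.

Lemma sum_Im_delta2 (R : realType) (J K : nat) (dx dy : R) (w : grid R J K) :
  (0 < J)%N -> (0 < K)%N -> zero_bdry w ->
  \sum_(p : 'I_J.+1 * 'I_K.+1 | inner_index p.1 p.2)
     complex.Im (delta2 dx dy w p.1 p.2 * (w p.1 p.2)^*%C) = 0.
Proof.
move=> J0 K0 [wx wy].
have ImM (r : R) (z : R[i]) :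
    complex.Im (z / r%:C ^+ 2) = complex.Im z / r ^+ 2.
  by rewrite -rmorphXn -fmorphV; case: z => x y; simpc => /=; ring.
pose X (j : 'I_J.+1) (k : 'I_K.+1) := complex.Im
  ((w (inord j.+1) k - 2 * w j k + w (inord j.-1) k) * (w j k)^*%C).
pose Y (j : 'I_J.+1) (k : 'I_K.+1) := complex.Im
  ((w j (inord k.+1) - 2 * w j k + w j (inord k.-1)) * (w j k)^*%C).
rewrite (eq_bigr (fun p => X p.1 p.2 / dx ^+ 2 + Y p.1 p.2 / dy ^+ 2));
  last first.
  by move=> -[j k] _ /=; rewrite /delta2 mulrDl raddfD/= ![_ / _ * _]mulrAC !ImM.
rewrite big_split -!mulr_suml.
rewrite -(pair_big (fun j : 'I_J.+1 => (0 < j < J)%N)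
  (fun k : 'I_K.+1 => (0 < k < K)%N) X).
rewrite -(pair_big (fun j : 'I_J.+1 => (0 < j < J)%N)
  (fun k : 'I_K.+1 => (0 < k < K)%N) Y).
rewrite exchange_big/=.
have inord0 n : inord 0 = ord0 :> 'I_n.+1 by apply: val_inj; rewrite /= inordK.
have inordn n : inord n = ord_max :> 'I_n.+1 by apply: val_inj; rewrite /= inordK.
have X0 k : \sum_(j < J.+1 | (0 < j < J)%N) X j k = 0.
  rewrite sum_inner_ord// -[RHS](sum_Im_laplacian (f := fun j => w (inord j) k) J0).
  - by apply: eq_big_nat => j /andP[_ jJ]; rewrite /X inordK// ltnW.
  - by rewrite inord0 (wx k).1.
  - by rewrite inordn (wx k).2.
have Y0 j : \sum_(k < K.+1 | (0 < k < K)%N) Y j k = 0.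
  rewrite sum_inner_ord// -[RHS](sum_Im_laplacian (f := fun k => w j (inord k)) K0).
  - by apply: eq_big_nat => k /andP[_ kK]; rewrite /Y inordK// ltnW.
  - by rewrite inord0 (wy j).1.
  - by rewrite inordn (wy j).2.
by rewrite !big1 ?mul0r ?addr0.
Qed.

(** * Decay of the mass *)

(** The energy identity at one node: the imaginary part of the scheme times the
    conjugate of the midpoint h.  The cubic and quintic terms are real multiples
    of h, so they contribute real multiples of |h|^2; the inequality comes from
    discarding eps |h|^4. *)
Lemma sqnorm_step (R : realType) (lambda nu eps tau : R) (z w D : R[i]) :
  0 <= eps -> 0 < tau ->
  'i * ((z - w) / tau%:C) + D + lambda%:C * psi1 z w - nu%:C * psi2 z w
    + 'i * eps%:C * phi z w = 0 ->
  sqnorm z <= sqnorm w - 2 * tau * complex.Im (D * ((z + w) / 2)^*%C).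
Proof.
move=> eps0 tau0; pose h := (z + w) / 2.
rewrite /psi1 /psi2 /phi -/h -complexiE => E.
pose p1 := (sqnorm z + sqnorm w) / 2.
pose p2 := (sqnorm z ^+ 2 + sqnorm z * sqnorm w + sqnorm w ^+ 2) / 3.
have E2 : (tau^-1)%:C * ('i%C * ((z - w) * h^*%C)) + D * h^*%C
    + ((lambda * p1 - nu * p2) * sqnorm h)%:C
    + 'i%C * (eps * sqnorm h ^+ 2)%:C = 0.
  have hh : h * h^*%C = (sqnorm h)%:C by rewrite -sqr_normc sqr_normcE.
  have n4 (x : R[i]) : `|x| ^+ 4 = (sqnorm x)%:C ^+ 2.
    by rewrite -[4%N]/(2 * 2)%N exprM sqr_normcE.
  have := congr1 (fun x => x * h^*%C) E; rewrite mul0r => E2; rewrite -[RHS]E2.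
  (* The morphism is abstract here because the concrete embedding of R into
     R[i] unfolds during rewriting and splits sums into components. *)
  have p1E (f : {rmorphism R -> R[i]}) a b : f ((a + b) / 2) = (f a + f b) / 2.
    by rewrite rmorphM fmorphV rmorph_nat rmorphD.
  have p2E (f : {rmorphism R -> R[i]}) a b :
      f ((a ^+ 2 + a * b + b ^+ 2) / 3) = (f a ^+ 2 + f a * f b + f b ^+ 2) / 3.
    by rewrite rmorphM fmorphV rmorph_nat 2!(rmorphD f) 2!(rmorphXn f) (rmorphM f).
  have {}p1E := p1E (real_complex R); have {}p2E := p2E (real_complex R).
  rewrite !n4 !sqr_normcE -p1E -p2E -/p1 -/p2 fmorphV.
  move: p1 p2 {p1E p2E n4 E2} => p1 p2.
  have -> (a b c : R) : ((lambda * a - nu * b) * c)%:C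
       = (lambda%:C * a%:C - nu%:C * b%:C) * c%:C :> R[i].
    by rewrite rmorphM rmorphB !rmorphM.
  have -> (c : R) : (eps * c ^+ 2)%:C = eps%:C * c%:C ^+ 2 :> R[i].
    by rewrite rmorphM (rmorphXn (real_complex R)).
  rewrite -hh; move: h^*%C => {hh} g.
  by ring.
move: (congr1 (@complex.Im _) E2) => {E2 E}.
rewrite !raddfD/=.
have -> : complex.Im ((tau^-1)%:C * ('i%C * ((z - w) * h^*%C)))
        = tau^-1 * ((sqnorm z - sqnorm w) / 2).
  have -> : h = (2^-1)%:C * (z + w) by rewrite fmorphV rmorph_nat mulrC.
  rewrite /sqnorm; case: z {h p1 p2} w => [a b] [e f].
  by simpc => /=; ring.
rewrite !mul0r mul1r add0r addr0 => E.
have -> : sqnorm z = sqnorm w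
    - 2 * tau * (complex.Im (D * h^*%C) + eps * sqnorm h ^+ 2).
  apply/eqP; rewrite -subr_eq0; apply/eqP.
  rewrite -[RHS](mulr0 (2 * tau)) -[X in _ = _ * X]E.
  by field; rewrite gt_eqF.
rewrite lerD2l lerN2; apply: ler_wpM2l; first by rewrite mulr_ge0// ltW.
by rewrite lerDl mulr_ge0// sqr_ge0.
Qed.

Definition mass (R : realType) (J K : nat) (u : grid R J K) : R :=
  \sum_(p : 'I_J.+1 * 'I_K.+1 | inner_index p.1 p.2) sqnorm (u p.1 p.2).

Lemma zero_bdry_midpoint (R : realType) (J K : nat) (u v : grid R J K) :
  zero_bdry u -> zero_bdry v -> zero_bdry (2^-1 *: (v + u)).
Proof.
move=> [ux uy] [vx vy]; split=> i; split; rewrite !mxE;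
  by rewrite ?(ux i).1 ?(ux i).2 ?(vx i).1 ?(vx i).2
             ?(uy i).1 ?(uy i).2 ?(vy i).1 ?(vy i).2 addr0 mulr0.
Qed.

Lemma zero_bdryP (R : realType) (J K : nat) (u : grid R J K) :
  zero_bdry u <-> forall j k, ~~ inner_index j k -> u j k = 0.
Proof.
split=> [[ux uy] j k|u0].
  have ord0E n (i : 'I_n.+1) : (i <= 0)%N -> i = ord0.
    by move=> i0; apply/val_inj/eqP; rewrite -leqn0.
  have ord_maxE n (i : 'I_n.+1) : (n <= i)%N -> i = ord_max.
    by move=> ni; apply/val_inj/eqP; rewrite eqn_leq ni -ltnS ltn_ord.
  rewrite /inner_index !negb_and -!leqNgt => /orP[/orP[]|/orP[]].
  - by move/ord0E ->; rewrite (ux k).1.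
  - by move/ord_maxE ->; rewrite (ux k).2.
  - by move/ord0E ->; rewrite (uy j).1.
  - by move/ord_maxE ->; rewrite (uy j).2.
by split=> i; split; apply: u0; rewrite /inner_index /= ?ltnn ?andbF.
Qed.

(** Sum of [sqnorm_step] over the inner nodes; the Laplacian terms cancel. *)
Lemma mass_step (R : realType) (lambda nu eps : R) (J K : nat)
    (dx dy tau : R) (u v : grid R J K) :
  (0 < J)%N -> (0 < K)%N -> 0 <= eps -> 0 < tau -> zero_bdry u ->
  cnfd_step lambda nu eps dx dy tau u v -> mass v <= mass u.
Proof.
move=> J0 K0 eps0 tau0 ubd [vbd E].
pose w : grid R J K := 2^-1 *: (v + u).
have wE j k : w j k = (v j k + u j k) / 2 by rewrite !mxE mulrC.
have := sum_Im_delta2 dx dy J0 K0 (zero_bdry_midpoint ubd vbd); rewrite -/w => w0.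
rewrite -[leRHS]subr0 -(mulr0 (2 * tau)) -w0 mulr_sumr -sumrB.
apply: ler_sum => -[j k] /= jk; rewrite wE.
exact: sqnorm_step (E j k jk).
Qed.

(** The squared modulus is at most m; the bound m + 1 avoids the square root of
    m, as m <= (m + 1)^2. *)
Lemma mass_entry_bound (R : realType) (J K : nat) (u : grid R J K) (m : R) :
  zero_bdry u -> mass u <= m -> entry_bound (m + 1)%:C u.
Proof.
move=> /zero_bdryP u0 um j k.
have mass0 : 0 <= mass u by apply: sumr_ge0 => *; exact: sqnorm_ge0.
have [jk|/u0 ->] := boolP (inner_index j k); last first.
  by rewrite normr0 ler0c; lra.
have le_mass : sqnorm (u j k) <= m.
  apply: le_trans um; rewrite /mass (bigD1 (j, k))//= lerDl.
  by apply: sumr_ge0 => *; exact: sqnorm_ge0.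
have m1 : 0 <= m + 1 by lra.
rewrite -(@ler_pXn2r _ 2)// ?nnegrE ?ler0c// sqr_normcE -rmorphXn lecR.
by have := sqnorm_ge0 (u j k); nra.
Qed.

(** * Boundary values of the initial sample *)

Lemma closure_itvoo (R : realType) (a b x : R) :
  a < b -> a <= x <= b -> closure `]a, b[ x.
Proof.
move=> ab /andP[ax xb] B /nbhs_ballP[e /= e0 eB].
(* Moving x towards the midpoint by a fraction t in (0, 1) enters the interval;
   the displacement is at most t (b - a) < e. *)
pose t := e / (e + (b - a)); pose y := x + t * ((a + b) / 2 - x).
have ba : 0 < e + (b - a) by lra.
have t0 : 0 < t by rewrite divr_gt0.
have t1 : t < 1 by rewrite ltr_pdivrMr//; lra.
have te : t * (b - a) < e.
  by rewrite /t mulrAC ltr_pdivrMr//; nra.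
exists y; split; first by rewrite /= in_itv/=; apply/andP; split; rewrite /y; nra.
by apply: eB; rewrite /ball/= ltr_norml /y; apply/andP; split; nra.
Qed.

Lemma boundary_rectangleP (R : realType) (a b c d x y : R) :
  a < b -> c < d -> a <= x <= b -> c <= y <= d ->
  ~~ ((a < x < b) && (c < y < d)) -> boundary (rectangle a b c d) (x, y).
Proof.
move=> ab cd xab ycd out; split.
  move=> B [[P Q] /= [nP nQ] PQ].
  have [x' [x'ab Px']] := closure_itvoo ab xab nP.
  have [y' [y'cd Qy']] := closure_itvoo cd ycd nQ.
  by exists (x', y'); split; [split|exact: PQ].
move=> /interior_subset[/=]; rewrite !in_itv/= => xi yi.
by move: out; rewrite xi yi.
Qed.

Lemma node_itv (R : realType) (a b : R) (J j : nat) :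
  a < b -> (0 < J)%N -> (j <= J)%N -> a <= node a b J j <= b.
Proof.
move=> ab J0 jJ; have J0' : 0 < J%:R :> R by rewrite ltr0n.
rewrite /node /mesh lerDl mulr_ge0//=; last by rewrite divr_ge0// subr_ge0 ltW.
rewrite -lerBrDl mulrCA ger_pMr ?subr_gt0//.
by rewrite ler_pdivrMr// mul1r ler_nat.
Qed.

Lemma node0 (R : realType) (a b : R) (J : nat) : node a b J 0 = a.
Proof. by rewrite /node mul0r addr0. Qed.

Lemma node_last (R : realType) (a b : R) (J : nat) :
  (0 < J)%N -> node a b J J = b.
Proof.
move=> J0; rewrite /node /mesh mulrC divfK ?pnatr_eq0 -?lt0n//.
by rewrite addrC subrK.
Qed.

Lemma sample_zero_bdry (R : realType) (a b c d : R) (J K : nat)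
    (u0 : R * R -> R[i]) :
  a < b -> c < d -> (0 < J)%N -> (0 < K)%N ->
  (forall p, boundary (rectangle a b c d) p -> u0 p = 0) ->
  zero_bdry (sample a b c d J K u0).
Proof.
move=> ab cd J0 K0 hu0.
have jab (j : 'I_J.+1) := node_itv ab J0 (ltn_ord j).
have kcd (k : 'I_K.+1) := node_itv cd K0 (ltn_ord k).
by split=> i; split; rewrite mxE hu0//; apply: boundary_rectangleP => //;
  rewrite ?node0 ?node_last ?ltxx ?lexx ?andbF// ltW.
Qed.

(** * The scheme as a fixed point problem *)

(** The scheme at node p reads i (v - u)/tau + cnfd_rhs = 0. *)
Definition cnfd_rhs (R : realType) (lambda nu eps : R) (J K : nat) (dx dy : R)
    (p : 'I_J.+1 * 'I_K.+1) (u v : grid R J K) : R[i] :=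
  delta2 dx dy (2^-1 *: (v + u)) p.1 p.2
  + lambda%:C * psi1 (v p.1 p.2) (u p.1 p.2)
  - nu%:C * psi2 (v p.1 p.2) (u p.1 p.2)
  + 'i * eps%:C * phi (v p.1 p.2) (u p.1 p.2).

Lemma cnfd_rhs_lipschitz (R : realType) (lambda nu eps : R) (J K : nat)
    (dx dy : R) :
  locally_lipschitz (@cnfd_rhs R lambda nu eps J K dx dy).
Proof.
have mid (g : 'I_J.+1 * 'I_K.+1 -> 'I_J.+1) (h : 'I_J.+1 * 'I_K.+1 -> 'I_K.+1) :
    locally_lipschitz
      (fun p (u v : grid R J K) => (2^-1 *: (v + u)) (g p) (h p)).
  have -> : (fun p (u v : grid R J K) => (2^-1 *: (v + u)) (g p) (h p))
          = (fun p u v => 2^-1 * (v (g p) (h p) + u (g p) (h p))).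
    by apply/funext => p; apply/funext => u; apply/funext => v; rewrite !mxE.
  apply: lipschitzM; first exact: lipschitz_cst.
  by apply: lipschitzD; [exact: lipschitz_new|exact: lipschitz_known].
rewrite /cnfd_rhs /delta2 /psi1 /psi2 /phi.
repeat match goal with
| |- locally_lipschitz (fun _ _ _ => _ + _) => apply: lipschitzD
| |- locally_lipschitz (fun _ _ _ => - _) => apply: lipschitzN
| |- locally_lipschitz (fun _ _ _ => _ * _) => apply: lipschitzM
| |- locally_lipschitz (fun _ _ _ => _ ^+ _) => apply: lipschitzX
| |- locally_lipschitz (fun _ _ _ => `|_|) => apply: lipschitz_norm
end.
all: first [ exact: mid | exact: lipschitz_cst
           | exact: lipschitz_new | exact: lipschitz_known ].
Qed.

(** The value 0 off the inner nodes builds the boundary condition into the map,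
    so that its fixed points are exactly the solutions of the scheme. *)
Definition step_map (R : realType) (lambda nu eps : R) (J K : nat)
    (dx dy tau : R) (u v : grid R J K) : grid R J K :=
  \matrix_(j, k) if inner_index j k
    then u j k + 'i * tau%:C * cnfd_rhs lambda nu eps dx dy (j, k) u v else 0.

Lemma cnfd_stepP (R : realType) (lambda nu eps : R) (J K : nat)
    (dx dy tau : R) (u v : grid R J K) : 0 < tau ->
  cnfd_step lambda nu eps dx dy tau u v <->
  step_map lambda nu eps dx dy tau u v = v.
Proof.
move=> tau0.
have t0 : tau%:C != 0 :> R[i] by rewrite (fmorph_eq0 (real_complex R)) gt_eqF.
have solve (z w F : R[i]) :
    'i * ((z - w) / tau%:C) + F = 0 <-> w + 'i * tau%:C * F = z.
  have -> : 'i * ((z - w) / tau%:C) + F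
    = 'i / tau%:C * (z - (w + 'i * tau%:C * F)) + ('i ^+ 2 + 1) * F by field.
  rewrite sqrCi addNr mul0r addr0; split=> [/eqP|<-]; last first.
    by rewrite subrr mulr0.
  rewrite mulf_eq0 mulf_eq0 invr_eq0 (negbTE t0) (negbTE (neq0Ci _)) /=.
  by rewrite subr_eq0 => /eqP.
have eqE j k : step_map lambda nu eps dx dy tau u v j k = v j k <->
    if inner_index j k then 'i * ((v j k - u j k) / tau%:C)
      + delta2 dx dy (2^-1 *: (v + u)) j k
      + lambda%:C * psi1 (v j k) (u j k)
      - nu%:C * psi2 (v j k) (u j k)
      + 'i * eps%:C * phi (v j k) (u j k) = 0 else v j k = 0.
  rewrite mxE; case: ifP => _; last by split.
  by rewrite -solve /cnfd_rhs /= !addrA.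
split=> [[/zero_bdryP v0 vE]|pv].
  apply/matrixP => j k; apply/eqE; case: ifP => [/vE//|jk].
  by apply: v0; rewrite jk.
have eqv j k : step_map lambda nu eps dx dy tau u v j k = v j k by rewrite pv.
split.
  by apply/zero_bdryP => j k jk; have /eqE := eqv j k; rewrite (negbTE jk).
by move=> j k jk; have /eqE := eqv j k; rewrite jk.
Qed.

(** With l a bound and Lipschitz constant of the right-hand side on the ball of
    radius 2 (m + 1), the condition 4 tau (l + 1) <= 1 makes the increment
    smaller than 1 and the contraction factor at most 1/4. *)
Lemma step_map_contraction (R : realType) (lambda nu eps : R) (J K : nat)
    (dx dy m : R) : exists2 tau0 : R, 0 < tau0 &
  forall tau (u : grid R J K), 0 < tau -> tau <= tau0 -> entry_bound m%:C u ->
  (forall v, entry_bound (2 * (m + 1))%:C v ->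
     entry_bound (m + 1)%:C (step_map lambda nu eps dx dy tau u v)) /\
  (forall v w (d : R), 0 <= d ->
     entry_bound (2 * (m + 1))%:C v -> entry_bound (2 * (m + 1))%:C w ->
     entry_bound d%:C (v - w) ->
     entry_bound (d / 4)%:C (step_map lambda nu eps dx dy tau u v
                           - step_map lambda nu eps dx dy tau u w)).
Proof.
have [L [Lbd Llip]] :=
  cnfd_rhs_lipschitz lambda nu eps J K dx dy (2 * (m + 1))%:C.
pose l := complex.Re `|L|.
have l0 : 0 <= l by rewrite -ler0c RRe_real ?normr_real.
(* L is only known as an element of R[i]; it is real as soon as it bounds a
   modulus. *)
have Ll (x : R[i]) : `|x| <= L -> L = l%:C.
  move=> xL; rewrite RRe_real ?normr_real// ger0_norm//.
  exact: le_trans xL.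
exists (4 * (l + 1))^-1; first by rewrite invr_gt0; lra.
move=> tau u tau0 tau_le um.
have tl : tau * l <= 1 / 4.
  have : tau * (4 * (l + 1)) <= 1.
    by rewrite -ler_pdivlMr ?div1r//; lra.
  by nra.
have m0 : 0 <= m by rewrite -ler0c; apply: le_trans (um ord0 ord0).
have u2 : entry_bound (2 * (m + 1))%:C u.
  by move=> j k; rewrite (le_trans (um j k))// lecR; lra.
have normit (F : R[i]) : `|'i * tau%:C * F| = tau%:C * `|F|.
  by rewrite !normrM normCi mul1r ger0_norm// ler0c ltW.
have t0 : 0 <= tau%:C :> R[i] by rewrite ler0c ltW.
split=> [v v2 j k|v w d d0 v2 w2 vwd j k].
  rewrite mxE; case: ifP => _; last by rewrite normr0 ler0c; lra.
  have F := Lbd (j, k) u v u2 v2; have LE := Ll _ F; rewrite LE in F.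
  have normF : `|'i * tau%:C * cnfd_rhs lambda nu eps dx dy (j, k) u v| <= 1%:C.
    rewrite normit; apply: le_trans (ler_wpM2l t0 F) _.
    by rewrite -rmorphM lecR; lra.
  apply: le_trans (ler_normD _ _) _; rewrite (rmorphD (real_complex R)).
  exact: lerD (um j k) normF.
have -> : (step_map lambda nu eps dx dy tau u v
          - step_map lambda nu eps dx dy tau u w) j k
    = step_map lambda nu eps dx dy tau u v j k
    - step_map lambda nu eps dx dy tau u w j k by rewrite mxE [X in _ + X]mxE.
rewrite ![step_map _ _ _ _ _ _ _ _ _ _]mxE; case: ifP => _; last first.
  by rewrite subrr normr0 ler0c divr_ge0.
rewrite opprD addrACA subrr add0r -mulrBr normit.
have F := Llip (j, k) u v w d%:C; rewrite ler0c in F.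
have {}F := F d0 u2 v2 w2 vwd.
rewrite (Ll _ (Lbd (j, k) u v u2 v2)) -rmorphM in F.
apply: le_trans (ler_wpM2l t0 F) _; rewrite -rmorphM lecR mulrA.
by have := ler_wpM2r d0 tl; lra.
Qed.

(** * Unique solvability *)

Theorem theorem3p7 (R : realType) (lambda nu eps T a b c d : R)
    (u0 : R * R -> R[i]) (J K : nat)
    (hnu : 0 < nu) (heps : 0 <= eps) (hT : 0 < T)
    (hab : a < b) (hcd : c < d)
    (hu0 : forall p : R * R, boundary (rectangle a b c d) p -> u0 p = 0)
    (hJ : (0 < J)%N) (hK : (0 < K)%N) (hmesh : mesh a b J = mesh c d K) :
  exists tau0 : R, 0 < tau0 /\
    forall (tau : R) (N : nat), 0 < tau -> tau <= tau0 -> N%:R * tau = T ->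
    forall (n : nat) (U : nat -> grid R J K), (n < N)%N ->
      zero_bdry (U n) ->
      cnfd_upto lambda nu eps a b c d u0 tau U n ->
      exists! V : grid R J K,
        cnfd_step lambda nu eps (mesh a b J) (mesh c d K) tau (U n) V.
Proof.
have s0 := sample_zero_bdry hab hcd hJ hK hu0.
pose m := mass (sample a b c d J K u0).
have m0 : 0 <= m by apply: sumr_ge0 => *; exact: sqnorm_ge0.
have [tau0 tau0_gt0 contr] := step_map_contraction lambda nu eps J K
  (mesh a b J) (mesh c d K) (m + 1).
exists tau0; split=> // tau N tau_gt0 tau_le _ n U _ Un0 [U0 Ustep].
have mass_le : forall l, (l <= n)%N -> mass (U l) <= m.
  elim=> [|l IH ln]; first by rewrite U0.
  apply: le_trans (IH (ltnW ln)).
  apply: mass_step (Ustep l ln) => //.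
  by case: l {IH} ln => [|l] ln; [rewrite U0|exact: (Ustep l (ltnW ln)).1].
have {}mass_le := mass_le n (leqnn n).
have [self contraction] := contr tau (U n) tau_gt0 tau_le
  (mass_entry_bound Un0 mass_le).
have [|V PV] := complex_grid_fixpoint _ self contraction; first by lra.
(* Every solution obeys the mass bound, so uniqueness in the ball suffices. *)
have sol_bound W :
    cnfd_step lambda nu eps (mesh a b J) (mesh c d K) tau (U n) W ->
    entry_bound (2 * (m + 1 + 1))%:C W.
  move=> UW j k; have /= := mass_step hJ hK heps tau_gt0 Un0 UW.
  move=> /le_trans/(_ mass_le)/(mass_entry_bound UW.1)/(_ j k)/le_trans; apply.
  by rewrite lecR; lra.
have UV : cnfd_step lambda nu eps (mesh a b J) (mesh c d K) tau (U n) V.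
  exact/(cnfd_stepP _ _ _ _ _ _ _ tau_gt0).
exists V; split=> // W UW.
apply: (complex_grid_fixpoint_unique contraction) => //; try exact: sol_bound.
exact/(cnfd_stepP _ _ _ _ _ _ _ tau_gt0).
Qed.
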